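(* Let $R$ be a commutative ring and let $n\ge 1$ be an integer. The following are equivalent: (1) Every matrix in $\mathbb{M}_n(R)$ is a sum of three involutive matrices of $\mathbb{M}_n(R)$. (2) $R$ is a subdirect product of $\mathbb{Z}_3$'s.
   Context: Rings are associative with $1$. $\mathbb{M}_n(R)$ is the ring of $n\times n$ matrices over $R$, with identity $I_n$. A matrix $A\in\mathbb{M}_n(R)$ is involutive if $A^2=I_n$. $\mathbb{Z}_3$ is the ring of integers modulo $3$; a ring is a subdirect product of $\mathbb{Z}_3$'s if it is isomorphic to a (unital) subring of a direct product of copies of $\mathbb{Z}_3$ (over an arbitrary index set, the empty family giving the zero ring) projecting onto each factor. *)

(* Defs.v *)
From mathcomp Require Import all_boot all_order all_algebra.
From mathcomp Require Import all_classical.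

Set Implicit Arguments.
Unset Strict Implicit.
Unset Printing Implicit Defensive.

Import GRing.Theory.

Local Open Scope ring_scope.

Definition involutive_mx (R : comPzRingType) (n : nat) (A : 'M[R]_n) : Prop :=
  A *m A = 1%:M.

(* [I -> 'Z_3] carries the pointwise ring structure, i.e. it is the direct
   product of copies of Z/3Z indexed by an arbitrary, possibly empty, type [I].
   Rings are of type [comPzRingType], so that the zero ring is allowed; ring
   morphisms preserve 1, so the image of [phi] is a unital subring. *)
Definition subdirect_product_Z3 (R : comPzRingType) : Prop :=
  exists (I : Type) (phi : {rmorphism R -> (I -> 'Z_3)}),
    injective phi /\ forall (i : I) (z : 'Z_3), exists x : R, phi x i = z.

(* Main.v *)
Require Import Defs.
From HB Require Import structures.
From mathcomp Require Import all_boot all_order all_algebra all_fingroup.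
From mathcomp Require Import all_classical.
From mathcomp Require Import ring zify.

Set Implicit Arguments.
Unset Strict Implicit.
Unset Printing Implicit Defensive.

Import GRing.Theory.
Local Open Scope ring_scope.

(** (2) implies (1).  A ring satisfying (2) is determined by its homomorphisms to
    [Z_3], and a matrix over it is a combination, with orthogonal idempotent
    coefficients, of finitely many matrices over [Z_3]; so let the base ring be
    [F_3].  By cyclic decomposition of [A + 1] one may take [A + 1] to be a
    companion matrix, and then [A] is an explicit sum of two bidiagonal
    involutions and one differing from [-1] in the last row only.

    (1) implies (2).  Modulo 2, the square of the trace of a sum of three
    involutions depends only on [n], so 2 is invertible.  Decomposing the scalar
    matrix [x] gives [x (x^2 - 1) (x^2 - 9) = 0]; with [x = 2] this yields
    [15 = 0].  If 3 were nonzero, [R] would map to [F_5], over which some matrix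
    is not a sum of three involutions.  Hence [3 = 0], and
    [tr (A^3) = (tr A)^3] gives [x^3 = x] for all [x]; homomorphisms to [Z_3] then
    separate the points of [R]. *)

(** * Krylov matrices and splitting off a cyclic block *)

Definition krylov (F : fieldType) n (M : 'M[F]_n) d (x : 'rV_n) : 'M_(d, n) :=
  \matrix_(i < d) (x *m iter i (mulmx M) 1%:M).

(** The companion matrix, acting on row vectors from the right; its last row holds the coordinates
    of [x M^d] in [x, .., x M^(d-1)]. *)
Definition shift_mx (F : fieldType) d (c : 'rV[F]_d) : 'M_d :=
  \matrix_(i, j) if i.+1 == d then c 0 j else (j == i.+1 :> nat)%:R.

Section Krylov.
Variables (F : fieldType) (n : nat).
Implicit Types (M : 'M[F]_n) (x : 'rV[F]_n).
Local Notation pw M i := (iter i (mulmx M) 1%:M).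

Lemma pwD M i j : pw M (i + j) = pw M i *m pw M j.
Proof. by elim: i => [|i IH] /=; rewrite ?mul1mx // IH mulmxA. Qed.

Lemma pwSr M i : pw M i.+1 = pw M i *m M.
Proof. by rewrite -addn1 pwD /= mulmx1. Qed.

Lemma pw_tr M i : pw M^T i = (pw M i)^T.
Proof. by elim: i => [|i IH]; rewrite ?trmx1 // pwSr trmx_mul /= IH. Qed.

(** In a nontrivial relation among the [d + 1] rows the coefficient of [x M^d] cannot vanish, as the
    first [d] rows are free; dividing by it gives [c]. *)
Lemma krylov_next M d x :
  row_free (krylov M d x) -> ~~ row_free (krylov M d.+1 x) ->
  exists c, x *m pw M d = c *m krylov M d x.
Proof.
move=> free_d dep; apply: contrapT => no_c; case/negP: dep.
apply: inj_row_free => v.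
rewrite mulmx_sum_row big_ord_recr /= rowK => v0.
pose w := \row_(i < d) v 0 (widen_ord (leqnSn d) i).
have wE : w *m krylov M d x = - (v 0 ord_max *: (x *m pw M d)).
  apply/eqP; rewrite -addr_eq0 -v0 mulmx_sum_row; apply/eqP; congr (_ + _).
  by apply: eq_bigr => i _; rewrite !rowK mxE.
have v_max : v 0 ord_max = 0.
  apply/eqP/negP => /negP nz; apply: no_c.
  exists (- (v 0 ord_max)^-1 *: w).
  by rewrite -scalemxAl wE scalerN scaleNr opprK scalerA mulVf ?scale1r.
have w0 : w = 0.
  by apply: (row_free_inj free_d); rewrite wE v_max scale0r oppr0 mul0mx.
apply/rowP => i; rewrite mxE; case: (unliftP ord_max i) => [j ->|-> //].
have /rowP/(_ j) := w0; rewrite !mxE => <-; congr (v 0 _).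
by apply: val_inj; rewrite /= /bump leqNgt ltn_ord.
Qed.

Lemma krylov_shift M d x c : x *m pw M d = c *m krylov M d x ->
  krylov M d x *m M = shift_mx c *m krylov M d x.
Proof.
move=> xd; apply/row_matrixP => i; rewrite !row_mul !rowK -mulmxA -pwSr.
have [id|nd] := eqVneq i.+1 d.
  have -> : row i (shift_mx c) = c.
    by apply/rowP => j; rewrite !mxE id eqxx.
  by rewrite -xd id.
have lt_i1d : (i.+1 < d)%N by rewrite ltn_neqAle nd ltn_ord.
have -> : row i (shift_mx c) = delta_mx 0 (Ordinal lt_i1d).
  by apply/rowP => j; rewrite !mxE (negPf nd).
by rewrite -rowE rowK.
Qed.

(* The functional [f] vanishes on [x, .., x M^(d-1)] and is 1 on [x M^d], so the
   Hankel matrix [x M^(i+j) f] is antitriangular with ones on the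
   antidiagonal. *)
Lemma krylov_dual M d x : row_free (krylov M d.+1 x) ->
  exists2 f : 'rV_n, krylov M d.+1 x *m (krylov M^T d.+1 f)^T \in unitmx
    & row_free (krylov M^T d.+1 f).
Proof.
set X := krylov _ _ _ => freeX.
pose g := pinvmx X *m (delta_mx ord_max 0 : 'cV_d.+1).
have Xg : X *m g = delta_mx ord_max 0 by rewrite mulmxA mulmxVp ?mul1mx.
have xg (k : 'I_d.+1) : (x *m pw M k *m g) 0 0 = (k == d :> nat)%:R.
  have /(congr1 (row k)) := Xg; rewrite row_mul rowK => ->.
  by rewrite !mxE eqxx andbT.
suff unitH : X *m (krylov M^T d.+1 g^T)^T \in unitmx.
  exists g^T => //; rewrite /row_free eqn_leq rank_leq_row /=.
  rewrite -[X in (X <= _)%N](mxrank_unit unitH) -[X in (_ <= X)%N]mxrank_tr.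
  exact: mxrankM_maxr.
set H := X *m _.
have HE i j : H i j = (x *m pw M (i + j) *m g) 0 0.
  have -> : H i j = (row i X *m (row j (krylov M^T d.+1 g^T))^T) 0 0.
    by rewrite !mxE; apply: eq_bigr => k _; rewrite !mxE.
  by rewrite !rowK pw_tr -trmx_mul trmxK pwD !mulmxA.
clearbody H; suff : row_perm (perm rev_ord_inj) H \in unitmx.
  by rewrite row_permE unitmx_mul unitmx_perm.
rewrite -unitmx_tr unitmxE det_trig; last first.
  apply/is_trig_mxP => i j lt_ij; rewrite !mxE permE HE.
  have lt_k : (rev_ord j + i < d.+1)%N by rewrite /=; have := ltn_ord j; lia.
  by rewrite (xg (Ordinal lt_k)) /=; case: eqP => //=; have := ltn_ord j; lia.
rewrite big1 ?unitr1 // => i _; rewrite !mxE permE HE.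
have lt_k : (rev_ord i + i < d.+1)%N by rewrite /=; have := ltn_ord i; lia.
by rewrite (xg (Ordinal lt_k)) /=; case: eqP => //=; have := ltn_ord i; lia.
Qed.

End Krylov.

(* For [x] of maximal cyclic dimension d, the functional [f] dual to [x] also
   has maximal cyclic dimension d, whence the common kernel of
   [f, M f, .., M^(d-1) f] is an invariant complement of the cyclic subspace
   spanned by [x]. *)
Lemma cyclic_splitting (F : fieldType) n (M : 'M[F]_n.+1) :
  exists d m (c : 'rV[F]_d.+1) (M' : 'M[F]_m)
    (P : 'M_(d.+1 + m, n.+1)) (Q : 'M_(n.+1, d.+1 + m)),
  [/\ P *m Q = 1%:M, Q *m P = 1%:M & M = Q *m block_mx (shift_mx c) 0 0 M' *m P].
Proof.
pose cyc d := `[< exists x, row_free (krylov M d x) >].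
have cyc1 : exists d, cyc d.
  exists 0%N; apply/asboolP; exists 0.
  by rewrite /row_free -leqn0 rank_leq_row.
have cyc_le d : cyc d -> (d <= n.+1)%N.
  by case/asboolP => x; rewrite /row_free => /eqP <-; apply: rank_leq_col.
case: (ex_maxnP cyc1 cyc_le) => -[|d] /asboolP[x freeX] max_d.
  suff /max_d : cyc 1%N by [].
  apply/asboolP; exists (delta_mx 0 0); apply: inj_row_free => v.
  rewrite mulmx_sum_row big_ord1 rowK /= mulmx1 => /rowP/(_ 0).
  rewrite !mxE !eqxx mulr1 => v0.
  by apply/rowP => i; rewrite ord1 v0 mxE.
have max_x y : ~~ row_free (krylov M d.+2 y).
  by apply/negP => free; have := max_d d.+2; rewrite ltnn => /implyP;
    rewrite implybF => /asboolP; apply; exists y.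
have [f unitH freeY] := krylov_dual freeX.
set X := krylov M d.+1 x in freeX unitH.
set Y := (krylov M^T d.+1 f)^T in unitH.
have [c /krylov_shift XM] := krylov_next freeX (max_x x).
(* If [f] generated [d.+2] independent vectors under [M^T], its dual vector would do the same under
   [M], against the maximality of [d.+1]. *)
have [c' /krylov_shift /(congr1 trmx)] : exists c',
    f *m iter d.+1 (mulmx M^T) 1%:M = c' *m krylov M^T d.+1 f.
  apply: krylov_next => //; apply/negP => /krylov_dual[y _].
  by rewrite trmxK => free_y; have := max_x y; rewrite free_y.
rewrite !trmx_mul trmxK -/Y => MY.
pose Z := row_base (kermx Y).
have ZY : Z *m Y = 0 by apply/eqP; rewrite -sub_kermx eq_row_base.
have /submxP[M' ZM] : (Z *m M <= Z)%MS.
  rewrite eq_row_base sub_kermx -mulmxA MY.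
  by rewrite (mulmxA Z) ZY mul0mx.
have rankY : \rank Y = d.+1 by rewrite mxrank_tr; apply/eqP.
(* Multiplying a relation by [Y] kills the [Z] part and leaves the invertible [X Y], so the [X] part
   vanishes first. *)
have freeP : row_free (col_mx X Z).
  apply: inj_row_free => v; rewrite -[v]hsubmxK mul_row_col => v0.
  have l0 : lsubmx v = 0.
    apply: (can_inj (mulmxK unitH)); rewrite mul0mx.
    have /(congr1 (mulmx^~ Y)) := v0.
    by rewrite mulmxDl -(mulmxA _ X) -(mulmxA _ Z) ZY mulmx0 addr0 mul0mx.
  move: v0; rewrite l0 mul0mx add0r => v0.
  suff -> : rsubmx v = 0 by rewrite row_mx0.
  by apply: (row_free_inj (row_base_free (kermx Y))); rewrite v0 mul0mx.
have fullP : row_full (col_mx X Z).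
  have leY : (\rank Y <= n.+1)%N by apply: rank_leq_row.
  by rewrite /row_full (eqP freeP) mxrank_ker rankY subnKC // -rankY.
exists d, _, c, M', (col_mx X Z), (pinvmx (col_mx X Z)).
rewrite mulmxVp // mulVpmx //; split=> //.
rewrite -mulmxA mul_block_col !mul0mx add0r addr0 -XM -ZM -mul_col_mx mulmxA.
by rewrite mulVpmx // mul1mx.
Qed.

(** * Three involutions over the field with three elements *)

Definition sum3_invol (R : comPzRingType) n (A : 'M[R]_n) : Prop :=
  exists A1 A2 A3 : 'M[R]_n,
    [/\ involutive_mx A1, involutive_mx A2, involutive_mx A3
      & A = A1 + A2 + A3].

Definition bidiag_mx (R : pzRingType) d (a u : nat -> R) : 'M[R]_d :=
  \matrix_(i, j) (if j == i then a i else if j == i.+1 :> nat then u i else 0).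

(** The square has diagonal [a_i^2], first superdiagonal [u_i (a_i + a_(i+1))] and second
    superdiagonal [u_i u_(i+1)]. *)
Lemma bidiag_involutive (R : comPzRingType) d (a u : nat -> R) :
    (forall i, a i * a i = 1) ->
    (forall i, (i.+1 < d)%N -> u i * (a i + a i.+1) = 0) ->
    (forall i, u i * u i.+1 = 0) ->
  involutive_mx (bidiag_mx d a u).
Proof.
move=> aa uaa uu; apply/row_matrixP => i; rewrite row_mul.
set A := bidiag_mx d a u.
have [lt_i|ge_i] := ltnP i.+1 d.
  pose i' := Ordinal lt_i.
  have rowA : row i A = a i *: delta_mx 0 i + u i *: delta_mx 0 i'.
    apply/rowP => j; rewrite !mxE /= -!val_eqE /=.
    have [->|_] := eqVneq (j : nat) i.
      by rewrite (ltn_eqF (ltnSn i)) mulr1 mulr0 addr0.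
    by rewrite mulr0 add0r; case: eqP; rewrite ?mulr1 ?mulr0.
  rewrite rowA mulmxDl -!scalemxAl -!rowE rowA.
  apply/rowP => j; rewrite !mxE /=.
  have := aa i; have := uaa i lt_i; have := uu i.
  rewrite -!val_eqE /=; set b := a i.+1; set w := u i.+1.
  move=> uw uab aai.
  have [->|nj] := eqVneq (j : nat) i.
    by rewrite (ltn_eqF (ltnSn i)) (ltn_eqF (leqW (ltnSn i))) !mulr0 !addr0 !mulr1.
  rewrite mulr0 add0r /=; case: eqP => [_|_]; last first.
    by case: eqP; rewrite !mulr0 ?add0r ?uw.
  by rewrite mulr1 [a i * u i]mulrC -mulrDr uab.
have rowA : row i A = a i *: delta_mx 0 i.
  apply/rowP => j; rewrite !mxE /=.
  have [_|_] := eqVneq j i; rewrite ?mulr1 // mulr0.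
  by case: eqP => // ji; move: (ltn_ord j); rewrite ji ltnNge ge_i.
rewrite rowA -!scalemxAl -!rowE rowA scalerA aa scale1r.
by rewrite rowE mulmx1.
Qed.

(* Over [F_3] the first two involutions add up to the matrix with ones above the
   diagonal whose only other nonzero entry is [s + r], in the last row; this
   corner entry is chosen so that what remains is an idempotent up to sign. *)
Lemma shift_mx_sum3 (F : fieldType) d (c : 'rV[F]_d.+1) :
    3%:R = 0 :> F -> (forall x : F, [\/ x = 0, x = 1 | x = -1]) ->
  sum3_invol (shift_mx c - 1%:M).
Proof.
move=> F3 Fcase.
(* Every element is a sum of two signs. The value 2 will be the corner of [Q], so that [Q^2 = 2 Q]
   and hence [(Q - 1)^2 = 1]. *)
have [s [r [s2 r2 sr]]] : exists s r : F,
    [/\ s * s = 1, r * r = 1 & c 0 ord_max - s - r = 2%:R].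
  have [tau|tau|tau] := Fcase (c 0 ord_max + 1).
  - exists 1, (-1); split; [by rewrite mulr1 | by rewrite mulrNN mulr1|].
    by transitivity (c 0 ord_max + 1 + 2%:R - 3%:R :> F); [ring | rewrite tau F3; ring].
  - exists (-1), (-1); rewrite mulrNN mulr1; split=> //.
    by transitivity (c 0 ord_max + 1 + 1 :> F); [ring | rewrite tau; ring].
  exists 1, 1; rewrite mulr1; split=> //.
  by transitivity (c 0 ord_max + 1 + 1 + 2%:R - 3%:R - 3%:R :> F);
    [ring | rewrite tau F3; ring].
(* Counting parity from [d] gives [a d = s] and assigns the last superdiagonal one to [A1]; the last
   sign [r] of [A2] is then unconstrained by its neighbour. *)
pose a i := s * (-1) ^+ odd (d + i).
pose b i := if i == d then r else - a i.
pose A1 := bidiag_mx d.+1 a (fun i => (odd (d + i))%:R).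
pose A2 := bidiag_mx d.+1 b (fun i => (~~ odd (d + i))%:R).
have aa i : a i * a i = 1.
  by rewrite /a mulrACA s2 mul1r -expr2 sqrr_sign.
have aS i : a i.+1 = - a i.
  by rewrite /a addnS /=; case: odd; rewrite /= ?mulrN1 ?mulr1 ?expr1 ?expr0; ring.
have A1_inv : involutive_mx A1.
  apply: bidiag_involutive => // [i _|i]; first by rewrite aS subrr mulr0.
  by rewrite addnS /= -natrM mulnb andbN.
have A2_inv : involutive_mx A2.
  apply: bidiag_involutive => [i|i lt_i|i].
  - by rewrite /b; case: ifP => _; rewrite ?mulrNN.
  - rewrite /b (ltn_eqF (_ : (i < d)%N)) //.
    have [<-|_] := eqVneq i.+1 d; last by rewrite aS subrr mulr0.
    by rewrite addSn addnn /= odd_double mul0r.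
  by rewrite addnS /= -natrM mulnb negbK andNb.
pose Q := shift_mx c - A1 - A2.
have QE i j : Q i j = if i == ord_max then Q i j else 0.
  case: eqVneq => // ni; rewrite !mxE.
  have lt_i : (i < d)%N by rewrite ltn_neqAle -ltnS ltn_ord andbT -(val_eqE i ord_max) in ni *.
  rewrite eqSS /b (ltn_eqF lt_i) -val_eqE.
  have [->|_] := eqVneq (j : nat) i.
    by rewrite (ltn_eqF (ltnSn i)) /=; ring.
  by case: eqP => _; [case: odd|]; rewrite /=; ring.
have Qmax : Q ord_max ord_max = 2%:R.
  by rewrite !mxE !eqxx /b eqxx /a addnn odd_double /= expr0 mulr1.
have QQ : Q *m Q = 2%:R *: Q.
  apply/matrixP => i k; rewrite mxE (bigD1 ord_max) //= big1 ?addr0 => [|j nj].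
    rewrite (mxE _ _ i k); case: (eqVneq i ord_max) => [->|ni]; first by rewrite Qmax.
    by rewrite QE (negPf ni) mul0r [Q i k]QE (negPf ni) mulr0.
  by rewrite [Q j k]QE (negPf nj) mulr0.
have cE : shift_mx c = A1 + A2 + Q by rewrite [RHS]addrC [A1 + A2]addrC [RHS]addrA !subrK.
clearbody Q; exists A1, A2, (Q - 1%:M); split=> //.
  rewrite /involutive_mx mulmxBl !mulmxBr QQ !mul1mx mulmx1 scaler_nat mulr2n.
  by rewrite addrK opprB addrCA subrr addr0.
by rewrite cE addrA.
Qed.

Lemma sum3_invol_F3 (F : fieldType) n (A : 'M[F]_n) :
    3%:R = 0 :> F -> (forall x : F, [\/ x = 0, x = 1 | x = -1]) ->
  sum3_invol A.
Proof.
move=> F3 Fcase; elim/ltn_ind: n A => -[|n] IH A.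
  by exists 1%:M, 1%:M, 1%:M; rewrite /involutive_mx mulmx1; split=> //;
    apply/matrixP; case.
have [d [m [c [M' [P [Q [PQ QP AE]]]]]]] := cyclic_splitting (A + 1%:M).
(* [Q] has the left inverse [P], so its rank is [d.+1 + m]; this compares the sizes without a
   cast. *)
have lt_mn : (m < n.+1)%N.
  apply: leq_trans (rank_leq_row Q).
  have /eqP -> : row_full Q by apply/row_fullP; exists P.
  by rewrite addSn ltnS leq_addl.
have [B1 [B2 [B3 [iB1 iB2 iB3 BE]]]] := shift_mx_sum3 c F3 Fcase.
have [C1 [C2 [C3 [iC1 iC2 iC3 CE]]]] := IH m lt_mn (M' - 1%:M).
pose D B C := Q *m block_mx B 0 0 C *m P.
have D_inv B C : involutive_mx B -> involutive_mx C -> involutive_mx (D B C).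
  move=> iB iC; rewrite /involutive_mx /D -!mulmxA (mulmxA P) PQ mul1mx.
  rewrite (mulmxA (block_mx _ _ _ _)) mulmx_block iB iC.
  by rewrite !mulmx0 !mul0mx !addr0 !add0r -scalar_mx_block mul1mx.
exists (D B1 C1), (D B2 C2), (D B3 C3); split; try exact: D_inv.
rewrite -!mulmxDl -!mulmxDr !add_block_mx !addr0 -BE -CE.
rewrite -[LHS](addrK 1%:M) AE -QP -{2}[Q]mulmx1 -mulmxBl -mulmxBr.
by rewrite (scalar_mx_block d.+1 m) opp_block_mx add_block_mx !subr0.
Qed.

(** * Homomorphisms to prime fields, and lifting from [Z_3] *)

Lemma rmorphism_of (R S : pzRingType) (f : R -> S) :
    zmod_morphism f -> monoid_morphism f ->
  exists F : {rmorphism R -> S}, F =1 f.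
Proof.
move=> fB fM.
pose fa := GRing.isZmodMorphism.Build _ _ f fB.
pose fm := GRing.isMonoidMorphism.Build _ _ f fM.
pose F : {rmorphism R -> S} := HB.pack f fa fm.
by exists F.
Qed.

(* A ring homomorphism to ['F_p] as the residue map of an ideal maximal among
   those avoiding [e]; the last hypothesis forces its residue ring to be
   ['F_p]. *)
Lemma residue_hom (R : comPzRingType) (p : nat) (e : R) :
    prime p -> e * e = e -> e != 0 -> e * p%:R = 0 ->
    (forall r, e * \prod_(i < p) (r - i%:R) = 0) ->
  exists f : {rmorphism R -> 'F_p}, f e = 1.
Proof.
move=> p_pr ee e_neq0 ep eprod.
pose P (I : set R) := [/\ ~ I e, forall x y, I x -> I y -> I (x + y)
  & forall r x, I x -> I (r * x)].
have [|I [[Ie ID IM] maxI]] := @Zorn_bigcup R P.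
  move=> C CP Ctot; split.
  - by case=> I /CP[Ie _ _].
  - move=> x y [I CI Ix] [J CJ Jy]; have [_ ID _] := CP _ CI.
    have [_ JD _] := CP _ CJ.
    have [IJ|JI] := Ctot _ _ CI CJ.
      by exists J => //; apply: JD => //; apply: IJ.
    by exists I => //; apply: ID => //; apply: JI.
  by move=> r x [I CI Ix]; exists I => //; have [_ _] := CP _ CI; apply.
(* [P] does not ask for [0], so the empty union of the empty chain satisfies it; [0] comes from
   maximality instead. *)
have I0 : I 0.
  apply: contrapT => nI0; apply: (maxI [set x | I x \/ x = 0]%classic).
    split; first by move=> x Ix; left.
    by move=> /(_ 0) /(_ (or_intror erefl)).
  split=> [[//|e0]|x y [Ix|->] [Iy|->]|r x [Ix|->]].
  - by rewrite e0 eqxx in e_neq0.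
  - by left; apply: ID.
  - by rewrite addr0; left.
  - by rewrite add0r; left.
  - by rewrite add0r; right.
  - by left; apply: IM.
  - by rewrite mulr0; right.
have gen a : ~ I a -> exists x r, I x /\ e = x + r * a.
  move=> nIa; apply: contrapT => nex.
  apply: (maxI [set y | exists x r, I x /\ y = x + r * a]%classic).
    split; first by move=> x Ix; exists x, 0; rewrite mul0r addr0.
    by move=> sub; apply/nIa/sub; exists 0, 1; rewrite mul1r add0r.
  split=> // [x y [x1 [r1 [I1 ->]]] [x2 [r2 [I2 ->]]]|r x [x1 [r1 [I1 ->]]]].
    by exists (x1 + x2), (r1 + r2); split; [apply: ID|ring].
  by exists (r * x1), (r * r1); split; [apply: IM|ring].
have Iprime a b : I (a * b) -> I a \/ I b.
  move=> Iab; apply: contrapT => /not_orP[/gen[x [r [Ix ex]]] /gen[y [s [Iy ey]]]].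
  apply: Ie; rewrite -ee {1}ex ey.
  have -> : (x + r * a) * (y + s * b) = (y + s * b) * x + (r * a * y + r * s * (a * b)).
    by ring.
  by apply: (ID); [apply: IM|apply: (ID); apply: IM].
have Ie1 : I (1 - e).
  by have [|//|//] := Iprime e (1 - e); rewrite mulrBr mulr1 ee subrr.
have Icancel x : e * x = 0 -> I x.
  by move=> ex0; have [|//|//] := Iprime e x; rewrite ex0.
have I1 : ~ I 1 by move=> /(IM e); rewrite mulr1.
have Ip : I p%:R by apply: Icancel.
have IB x y : I x -> I y -> I (x - y).
  by move=> Ix /(IM (-1)); rewrite mulN1r; apply: ID.
have Idvd k : I k%:R -> (k%:R : 'F_p) = 0.
  move=> Ik; apply/eqP; rewrite -(dvdn_pcharf (pchar_Fp p_pr)).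
  apply: contrapT => /negP; rewrite -prime_coprime // => /eqP cop.
  have [a _ /dvdnP[b]] := Bezoutl k (prime_gt0 p_pr); rewrite cop => ab.
  apply: I1; have -> : 1 = b%:R * p%:R - a%:R * k%:R :> R.
    by rewrite -!natrM -ab natrD addrK.
  by apply: IB; apply: IM.
have res_ex r : exists n : nat, I (r - n%:R).
  apply: contrapT => nex; have := Icancel _ (eprod r).
  elim/big_rec: _ => // i x _ IH /Iprime[Ii|//]; by apply: nex; exists (nat_of_ord i).
have res_uniq r n m : I (r - n%:R) -> I (r - m%:R) -> (n%:R : 'F_p) = m%:R.
  wlog le_mn : n m / (m <= n)%N.
    by move=> th; case: (leqP m n) => [/th//|/ltnW/th th' In Im]; rewrite th'.
  move=> In Im; have /Idvd : I (n - m)%:R.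
    by rewrite natrB //; have := IB _ _ Im In; congr I; ring.
  by rewrite natrB // => /eqP; rewrite subr_eq0 => /eqP.
pose g r := sval (cid (res_ex r)).
have gI r : I (r - (g r)%:R) by rewrite /g; case: cid.
pose f r : 'F_p := (g r)%:R.
have fE r n : I (r - n%:R) -> f r = n%:R by apply: res_uniq.
have fD x y : f (x + y) = f x + f y.
  rewrite -natrD; apply: fE; have := ID _ _ (gI x) (gI y); congr I.
  by rewrite natrD; ring.
have fB : zmod_morphism f.
  by move=> x y; apply/eqP; rewrite eq_sym subr_eq -fD subrK.
have fM : monoid_morphism f.
  split=> [|x y]; first by apply: (fE _ 1%N); rewrite subrr.
  rewrite -natrM; apply: fE; have := ID _ _ (IM y _ (gI x)) (IM (g x)%:R _ (gI y)).
  by congr I; rewrite natrM; ring.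
have [F FE] := rmorphism_of fB fM.
exists F; rewrite FE; apply: (fE _ 1%N); by have := IM (-1) _ Ie1; congr I; ring.
Qed.

(** For the converse all homomorphisms to [Z_3] serve as index set; each projection is onto because
    1 generates [Z_3]. *)
Lemma subdirect_product_Z3P (R : comPzRingType) :
  subdirect_product_Z3 R <->
  forall x y : R, (forall f : {rmorphism R -> 'Z_3}, f x = f y) -> x = y.
Proof.
split=> [[I [phi [phi_inj _]]] x y fxy|sep].
  apply: phi_inj; apply: funext => t.
  pose f r := phi r t.
  have fB : zmod_morphism f by move=> a b; rewrite /f rmorphB.
  have fM : monoid_morphism f.
    by split=> [|a b]; rewrite /f ?rmorph1 ?rmorphM.
  have [F FE] := rmorphism_of fB fM.
  by have := fxy F; rewrite !FE.
pose phi (x : R) := (fun f => f x) : {rmorphism R -> 'Z_3} -> 'Z_3.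
have phiB : zmod_morphism phi by move=> a b; apply: funext => f; apply: rmorphB.
have phiM : monoid_morphism phi.
  by split=> [|a b]; apply: funext => f; [apply: rmorph1|apply: rmorphM].
have [F FE] := rmorphism_of phiB phiM.
exists {rmorphism R -> 'Z_3}, F; split.
  by move=> x y; rewrite !FE => xy; apply: sep => f; have := congr1 (fun h => h f) xy.
by move=> f z; exists (nat_of_ord z)%:R; rewrite FE /phi rmorph_nat natr_Zp.
Qed.

Lemma sum3_invol_Z3 n (A : 'M['Z_3]_n) : sum3_invol A.
Proof.
apply: (@sum3_invol_F3 'F_3) => [|x]; first exact: val_inj.
by case: x => -[|[|[|//]]] lt_x; [constructor 1|constructor 2|constructor 3];
  apply: val_inj.
Qed.

Lemma subdirect_sum3 (R : comPzRingType) n (A : 'M[R]_n) :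
  subdirect_product_Z3 R -> sum3_invol A.
Proof.
move=> /subdirect_product_Z3P sep.
have /choice[g gP] : forall B : 'M['Z_3]_n,
    exists T : 'M['Z_3]_n * 'M['Z_3]_n * 'M['Z_3]_n,
    [/\ involutive_mx T.1.1, involutive_mx T.1.2, involutive_mx T.2
      & B = T.1.1 + T.1.2 + T.2].
  by move=> B; have [A1 [A2 [A3 ?]]] := sum3_invol_Z3 B; exists (A1, A2, A3).
(* In [Z_3], [1 - t^2] is the indicator of [t = 0]; so each [f] sends [e B] to 1 if [B] is the image
   of [A], and to 0 otherwise. *)
pose e (B : 'M['Z_3]_n) : R :=
  \prod_i \prod_j (1 - (A i j - (nat_of_ord (B i j))%:R) ^+ 2).
have fe (f : {rmorphism R -> 'Z_3}) B : f (e B) = (B == map_mx f A)%:R.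
  have Z3 (u v : 'Z_3) : 1 - (u - v) ^+ 2 = (v == u)%:R.
    by apply/eqP; case: u => -[|[|[|//]]] lu; case: v => -[|[|[|//]]] lv.
  rewrite rmorph_prod; under eq_bigr => i _.
    rewrite rmorph_prod; under eq_bigr => j _.
      rewrite rmorphB rmorph1 rmorphXn rmorphB rmorph_nat natr_Zp Z3.
    over. over.
  have [->|neq] := eqVneq B (map_mx f A).
    by rewrite big1 // => i _; rewrite big1 // => j _; rewrite mxE eqxx.
  have [i [j nij]] : exists i j, B i j != f (A i j).
    apply: contrapT => nex; case/eqP: neq; apply/matrixP => i j; rewrite mxE.
    by apply/eqP; apply: contrapT => /negP nij; apply: nex; exists i, j.
  by rewrite (bigD1 i) //= (bigD1 j) //= (negPf nij) !mul0r.
pose lift (h : 'M['Z_3]_n -> 'M['Z_3]_n) : 'M[R]_n :=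
  \matrix_(i, j) \sum_B e B * (nat_of_ord (h B i j))%:R.
have map_lift (f : {rmorphism R -> 'Z_3}) h : map_mx f (lift h) = h (map_mx f A).
  apply/matrixP => i j; rewrite !mxE rmorph_sum (bigD1 (map_mx f A)) //= big1.
    by rewrite rmorphM fe eqxx mul1r rmorph_nat natr_Zp addr0.
  by move=> B nB; rewrite rmorphM fe (negPf nB) mul0r.
have sep_mx (B C : 'M[R]_n) :
    (forall f : {rmorphism R -> 'Z_3}, map_mx f B = map_mx f C) -> B = C.
  move=> BC; apply/matrixP => i j; apply: sep => f.
  by have /matrixP/(_ i j) := BC f; rewrite !mxE.
exists (lift (fun B => (g B).1.1)), (lift (fun B => (g B).1.2)),
  (lift (fun B => (g B).2)); split; apply: sep_mx => f;
  rewrite ?map_mxD ?map_mxM ?map_mx1 !map_lift; by case: (gP (map_mx f A)).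
Qed.

(** * Traces of powers modulo 2 and 3, and scalar matrices *)

Lemma sum_symmetric (R : comPzRingType) n (f : 'I_n -> 'I_n -> R) :
    (forall i j, f i j = f j i) ->
  exists z, \sum_i \sum_j f i j = \sum_i f i i + 2%:R * z.
Proof.
move=> fC; pose s (q : rel 'I_n) := \sum_i \sum_(j | q i j) f i j.
exists (s (fun i j => (i < j)%N)).
have sC : s (fun i j => (j < i)%N) = s (fun i j => (i < j)%N).
  rewrite /s (exchange_big_dep predT) //=; apply: eq_bigr => i _.
  by apply: eq_bigr => j _; rewrite fC.
rewrite mulr_natl mulr2n -{2}sC addrA -!big_split; apply: eq_bigr => i _ /=.
rewrite (bigD1 i) //= -addrA; congr (_ + _).
rewrite (bigID (fun j : 'I_n => (i < j)%N)) /=; congr (_ + _);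
  by apply: eq_bigl => j; rewrite -val_eqE /=; lia.
Qed.

(* Every nonconstant triple has exactly one cyclic rotation [(i, j, k)] with
   [i <= j] and [i < k]. *)
Lemma sum_cyclic (R : comPzRingType) n (f : 'I_n -> 'I_n -> 'I_n -> R) :
    (forall i j k, f i j k = f j k i) ->
  exists z, \sum_i \sum_j \sum_k f i j k = \sum_i f i i i + 3%:R * z.
Proof.
move=> fC.
pose q (i j k : 'I_n) : R := ((i <= j) && (i < k))%N%:R.
pose S (h : 'I_n -> 'I_n -> 'I_n -> R) := \sum_i \sum_j \sum_k h i j k.
have SD h1 h2 : S h1 + S h2 = S (fun i j k => h1 i j k + h2 i j k).
  rewrite /S -big_split; apply: eq_bigr => i _.
  by rewrite -big_split; apply: eq_bigr => j _; rewrite -big_split.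
have Srot h : S h = S (fun i j k => h j k i).
  rewrite /S [RHS]exchange_big; apply: eq_bigr => i _.
  by rewrite exchange_big; apply: eq_bigr => j _.
exists (S (fun i j k => f i j k * q i j k)).
pose c (i j k : 'I_n) : R := ((i == j) && (i == k))%:R.
have -> : \sum_i f i i i = S (fun i j k => f i j k * c i j k).
  apply: eq_bigr => i _; rewrite (bigD1 i) //= (bigD1 i) //= /c eqxx mulr1.
  rewrite !big1 ?addr0 // => [j nij|k nik]; last by rewrite eq_sym (negPf nik) mulr0.
  by rewrite big1 // => k _; rewrite eq_sym (negPf nij) mulr0.
have -> : 3%:R * S (fun i j k => f i j k * q i j k) =
    S (fun i j k => f i j k * q i j k) + S (fun i j k => f i j k * q j k i)
    + S (fun i j k => f i j k * q k i j).
  have -> : S (fun i j k => f i j k * q j k i) = S (fun i j k => f i j k * q i j k).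
    rewrite [RHS]Srot; congr S; apply: funext => i; apply: funext => j.
    by apply: funext => k; rewrite [f i j k]fC.
  have -> : S (fun i j k => f i j k * q k i j) = S (fun i j k => f i j k * q i j k).
    rewrite [LHS]Srot; congr S; apply: funext => i; apply: funext => j.
    by apply: funext => k; rewrite [f i j k]fC.
  by ring.
rewrite !SD; apply: eq_bigr => i _; apply: eq_bigr => j _; apply: eq_bigr => k _.
rewrite -!mulrDr -[LHS]mulr1; congr (_ * _).
rewrite /c /q -!natrD -[LHS]/(1%:R); congr (_%:R).
by rewrite -!val_eqE /=; lia.
Qed.

(** Both sides are sums over index pairs, invariant under the swap and equal on the diagonal. For
    cubes, cyclic rotations of triples replace the swap. *)
Lemma mxtrace_sqr (R : comPzRingType) n (A : 'M[R]_n) :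
  exists z, \tr A ^+ 2 = \tr (A *m A) + 2%:R * z.
Proof.
have [|z1 E1] := @sum_symmetric R n (fun i j => A i i * A j j).
  by move=> i j; rewrite mulrC.
have [|z2 E2] := @sum_symmetric R n (fun i j => A i j * A j i).
  by move=> i j; rewrite mulrC.
exists (z1 - z2); have -> : \tr (A *m A) = \sum_i \sum_j A i j * A j i.
  by apply: eq_bigr => i _; rewrite mxE.
have -> : \tr A ^+ 2 = \sum_i \sum_j A i i * A j j by rewrite expr2 big_distrlr.
by rewrite E1 E2; ring.
Qed.

Lemma mxtrace_cube (R : comPzRingType) n (A : 'M[R]_n) :
  exists z, \tr A ^+ 3 = \tr (A *m A *m A) + 3%:R * z.
Proof.
have [|z1 E1] := @sum_cyclic R n (fun i j k => A i i * A j j * A k k).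
  by move=> i j k; rewrite -mulrA mulrC.
have [|z2 E2] := @sum_cyclic R n (fun i j k => A i j * A j k * A k i).
  by move=> i j k; rewrite -mulrA mulrC.
exists (z1 - z2).
have -> : \tr (A *m A *m A) = \sum_i \sum_j \sum_k A i j * A j k * A k i.
  apply: eq_bigr => i _; rewrite mxE exchange_big; apply: eq_bigr => k _.
  by rewrite mxE mulr_suml.
have -> : \tr A ^+ 3 = \sum_i \sum_j \sum_k A i i * A j j * A k k.
  rewrite exprSr expr2 big_distrlr mulr_suml; apply: eq_bigr => i _.
  rewrite mulr_suml; apply: eq_bigr => j _.
  by rewrite mulr_sumr.
by rewrite E1 E2; ring.
Qed.

(* Write [C = A1 + A2 = lam - A3]. Since [A3^2 = 1], [2 lam C] commutes with
   [A1], so that up to the factor [2 lam] the matrices [A1] and [A2] commute,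
   whence [C^3 = 4 C]; now use [C = lam - A3] and [A3^2 = 1] once more. *)
Lemma scalar_sum3 (R : comPzRingType) n (lam : R) (A1 A2 A3 : 'M[R]_n.+1) :
    involutive_mx A1 -> involutive_mx A2 -> involutive_mx A3 ->
    lam%:M = A1 + A2 + A3 ->
  2%:R * lam * (lam ^+ 2 - 1) * (lam ^+ 2 - 9%:R) = 0.
Proof.
rewrite /involutive_mx => i1 i2 i3 lamE.
pose C := A1 + A2; pose p := 2%:R * lam.
have CE : C = lam%:M - A3 by rewrite lamE addrK.
pose L (x y : R) : 'M[R]_n.+1 := x%:M + y *: A3.
have LM x y z t : L x y *m L z t = L (x * z + y * t) (x * t + y * z).
  rewrite /L mulmxDl !mulmxDr -scalar_mxM mul_scalar_mx mul_mx_scalar.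
  rewrite -scalemxAl -scalemxAr i3 scalerA -!scalerA.
  by apply/matrixP => i j; rewrite !mxE; ring.
have CL : C = L lam (-1) by rewrite CE /L scaleN1r.
have CC : C *m C = 2%:R%:M + A1 *m A2 + A2 *m A1.
  rewrite /C mulmxDl !mulmxDr i1 i2.
  by apply/matrixP => i j; rewrite !mxE; ring.
have pC : p *: C = C *m C + (lam ^+ 2 - 1)%:M.
  rewrite CL LM /L; apply/matrixP => i j; rewrite !mxE /p; ring.
(* Up to a scalar matrix, [p C] is [A1 A2 + A2 A1], which commutes with the involution [A1]. *)
have comm1 : (p *: C) *m A1 = A1 *m (p *: C).
  rewrite pC CC !mulmxDl !mulmxDr !mul_scalar_mx !mul_mx_scalar.
  rewrite -!mulmxA i1 !mulmxA i1 mulmx1 mul1mx.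
  by apply/matrixP => i j; rewrite !mxE; ring.
have comm12 : p *: (A2 *m A1) = p *: (A1 *m A2).
  move: comm1; rewrite -scalemxAl -scalemxAr /C mulmxDl mulmxDr !scalerDr.
  exact: addrI.
have p121 : p *: (A1 *m A2 *m A1) = p *: A2.
  by rewrite -mulmxA scalemxAr comm12 -scalemxAr mulmxA i1 mul1mx.
have pC3 : p *: (C *m C *m C) = p *: (4%:R *: C).
  rewrite scalemxAl CC !scalerDr comm12 -!scalerDr -scalemxAl /C.
  rewrite !mulmxDl !mulmxDr !mul_scalar_mx -(mulmxA A1 A2 A2) i2 mulmx1 !scalerDr p121.
  by apply/matrixP => i j; rewrite !mxE; ring.
have pq : L (p * (lam ^+ 2 - 1) * lam) (- (3%:R * p * (lam ^+ 2 - 1))) = 0.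
  apply/eqP; move/eqP: pC3; rewrite CL !LM -subr_eq0 => /eqP eq0; apply/eqP.
  by rewrite -eq0; apply/matrixP => i j; rewrite !mxE; ring.
(* The factor [lam + 3 A3] cancels the [A3] term and leaves the scalar wanted. *)
have : L (p * (lam ^+ 2 - 1) * lam) (- (3%:R * p * (lam ^+ 2 - 1))) *m L lam 3%:R = 0.
  by rewrite pq mul0mx.
rewrite LM => /matrixP/(_ 0 0); rewrite !mxE eqxx mulr1n => e0.
by rewrite -[RHS]e0 /p; ring.
Qed.

(** * Eigenspaces of involutions, and failure in characteristic 5 *)

Section InvolutionRanks.
Variables (F : fieldType) (n : nat).
Implicit Types (A B C D Q : 'M[F]_n).

Lemma involutive_rankD A : 2%:R != 0 :> F -> involutive_mx A ->
  (\rank (A + 1%:M)%R + \rank (A - 1%:M)%R)%N = n.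
Proof.
move=> nz2 iA; apply/eqP; rewrite eqn_leq; apply/andP; split.
  apply: mulmx0_rank_max; rewrite mulmxBr mulmx1 mulmxDl mul1mx iA.
  by rewrite [A + _]addrC subrr.
apply: (@leq_trans (\rank (2%:R%:M : 'M[F]_n))).
  by rewrite mxrank_unit // unitmxE det_scalar unitrX // unitfE.
have -> : (2%:R%:M : 'M[F]_n) = (A + 1%:M) + - (A - 1%:M).
  by apply/matrixP => i j; rewrite !mxE; ring.
by rewrite -(mxrank_opp (A - _)); apply: mxrank_add.
Qed.

(** In a full-rank factorization of an idempotent, the factors multiply to the identity in the
    reverse order. *)
Lemma mxtrace_idempotent Q : Q *m Q = Q -> \tr Q = (\rank Q)%:R.
Proof.
move=> QQ; rewrite -{1}(mulmx_base Q) mxtrace_mulC.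
suff -> : row_base Q *m col_base Q = 1%:M by rewrite mxtrace1.
apply: (row_full_inj (col_base_full Q)); apply: (row_free_inj (row_base_free Q)).
by rewrite mulmx1 mulmxA mulmx_base -mulmxA mulmx_base QQ.
Qed.

(** Each eigenspace has half the dimension, and [(A + 1) / 2] is an idempotent whose trace is its
    rank. *)
Lemma involutive_trace A : 2%:R != 0 :> F -> involutive_mx A ->
  \rank (A + 1%:M)%R = \rank (A - 1%:M)%R -> \tr A = 0.
Proof.
move=> nz2 iA eq_rank; pose r := \rank (A + 1%:M)%R.
have nE : n%:R = r%:R + r%:R :> F.
  by rewrite -natrD {2}/r eq_rank (involutive_rankD nz2 iA).
have /mxtrace_idempotent : (2%:R^-1 *: (A + 1%:M)) *m (2%:R^-1 *: (A + 1%:M))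
    = 2%:R^-1 *: (A + 1%:M).
  rewrite -scalemxAl -scalemxAr mulmxDl !mulmxDr iA !mulmx1 mul1mx.
  by apply/matrixP => i j; rewrite !mxE; field.
rewrite mxrank_scale_nz ?invr_eq0 // mxtraceZ mxtraceD mxtrace1 -/r nE.
move=> /(congr1 ( *%R 2%:R)); rewrite mulrA divff // mul1r.
by rewrite mulr_natl mulr2n => /eqP; rewrite -subr_eq0 addrK => /eqP.
Qed.

(** [D] maps the 1-eigenspace of [C] into the (-1)-eigenspace, injectively since [D^2 = 3] there. It
    is used with [C = A + B] and [D = A - B]. *)
Lemma anticommuting_rank_le C D : 3%:R != 0 :> F ->
    C *m D = - (D *m C) -> C *m C + D *m D = 4%:R%:M ->
  (\rank (C + 1%:M)%R <= \rank (C - 1%:M)%R)%N.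
Proof.
move=> nz3 CD CCDD.
pose K := kermx (C - 1%:M).
have KC : K *m C = K.
  by apply/eqP; rewrite -subr_eq0 -{2}[K]mulmx1 -mulmxBr mulmx_ker.
have KDD : K *m D *m D = 3%:R *: K.
  rewrite -mulmxA -[D *m D](addKr (C *m C)) CCDD mulmxDr mulmxN mulmxA !KC.
  by rewrite mul_mx_scalar; apply/matrixP => i j; rewrite !mxE; ring.
have le_KD : (K *m D <= kermx (C + 1%:M))%MS.
  by rewrite sub_kermx mulmxDr mulmx1 -mulmxA -[D *m C]opprK -CD mulmxN mulmxA KC addNr.
have rank_KD : (\rank K <= \rank (K *m D))%N.
  by rewrite -(mxrank_scale_nz K nz3) -KDD mxrankM_maxl.
have := leq_trans rank_KD (mxrankS le_KD); rewrite !mxrank_ker.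
have := rank_leq_row (C - 1%:M); have := rank_leq_row (C + 1%:M); lia.
Qed.

Lemma sum2_invol_rank A B : 3%:R != 0 :> F ->
    involutive_mx A -> involutive_mx B ->
  \rank (A + B + 1%:M)%R = \rank (A + B - 1%:M)%R.
Proof.
rewrite /involutive_mx => nz3 iA iB; set C := A + B; pose D := A - B.
have CD : C *m D = - (D *m C).
  rewrite /C /D !mulmxDl !mulmxDr !mulNmx !mulmxN iA iB.
  by apply/matrixP => i j; rewrite !mxE; ring.
have CCDD : C *m C + D *m D = 4%:R%:M.
  rewrite /C /D !mulmxDl !mulmxDr !mulNmx !mulmxN iA iB.
  by apply/matrixP => i j; rewrite !mxE; ring.
apply/eqP; rewrite eqn_leq (anticommuting_rank_le nz3 CD CCDD) /=.
have -> : C - 1%:M = - (- C + 1%:M) by rewrite opprD opprK.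
have -> : C + 1%:M = - (- C - 1%:M) by rewrite opprD !opprK.
rewrite !mxrank_opp; apply: (anticommuting_rank_le (D := D)) => //.
  by rewrite mulNmx CD mulmxN.
by rewrite mulNmx mulmxN opprK.
Qed.

End InvolutionRanks.

(** A rank drop gives a [w] with [w u v = w Q] nonzero; then [w u] is nonzero, and [y] is [w]
    rescaled. *)
Lemma rank1_drop_left (F : fieldType) n (Q : 'M[F]_n) (u : 'cV_n) (v : 'rV_n) :
    (\rank (u *m v - Q)%R < \rank Q)%N ->
  exists2 y : 'rV_n, y *m u = 1%:M & y *m Q = v.
Proof.
move=> lt_rank; apply: contrapT => ny.
have : (kermx (u *m v - Q) <= kermx Q)%MS.
  rewrite sub_kermx; apply/eqP/row_matrixP => i; rewrite row_mul row0.
  set w := row i _.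
  have wE : (w *m u) 0 0 *: v = w *m Q.
    have : w *m (u *m v - Q) = 0 by rewrite -row_mul mulmx_ker row0.
    rewrite mulmxBr mulmxA => /eqP; rewrite subr_eq0 => /eqP <-.
    by rewrite -mul_scalar_mx -mx11_scalar.
  have [wu0|nz_wu] := eqVneq ((w *m u) 0 0) 0; first by rewrite -wE wu0 scale0r.
  case: ny; exists (((w *m u) 0 0)^-1 *: w).
    by rewrite -scalemxAl [w *m u]mx11_scalar scale_scalar_mx mxE eqxx mulVf.
  by rewrite -scalemxAl -wE scalerA mulVf ?scale1r.
move=> /mxrankS; rewrite !mxrank_ker.
have := rank_leq_row (u *m v - Q); have := rank_leq_row Q; lia.
Qed.

(** With [y Q = v], and [Q x = u], [v x = 1] by transposition, [v u = y Q Q x = t (v x) = t]. *)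
Lemma rank1_drop (F : fieldType) n (Q : 'M[F]_n) (u : 'cV_n) (v : 'rV_n) t :
    Q *m Q = t *: Q -> (\rank (u *m v - Q)%R < \rank Q)%N ->
  v *m u = t%:M.
Proof.
move=> QQ lt_rank.
have [y _ yQ] := rank1_drop_left lt_rank.
have [|x vx Qx] := @rank1_drop_left F n Q^T v^T u^T.
  by rewrite -trmx_mul -linearB /= !mxrank_tr.
rewrite -{1}yQ -[u]trmxK -Qx trmx_mul trmxK mulmxA -(mulmxA y) QQ.
rewrite -scalemxAr yQ -scalemxAl -[v *m _]trmxK trmx_mul trmxK vx trmx1.
by rewrite scale_scalar_mx mulr1.
Qed.

(* In odd dimension the zero matrix fails, since the two eigenspaces of each
   summand must have the same dimension. In even dimension a rank-one idempotent
   fails: the same dimensions can differ by at most 2 and, by parity, can only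
   differ when the trace is 2 or -2; so all summands have trace zero. *)
Lemma not_sum3_invol_char5 (F : fieldType) n : 5%:R = 0 :> F ->
  exists A : 'M[F]_n.+1, ~ sum3_invol A.
Proof.
move=> F5.
have [nz2 nz3] : 2%:R != 0 :> F /\ 3%:R != 0 :> F.
  split; apply/eqP => e0; move: (oner_neq0 F).
    have -> : 1 = 5%:R - 2%:R * 2%:R :> F by ring.
    by rewrite F5 e0 mulr0 subr0 eqxx.
  have -> : 1 = 3%:R * 2%:R - 5%:R :> F by ring.
  by rewrite F5 e0 mul0r subr0 eqxx.
(* The dimension is [n.+1], so [odd n] is the even-dimensional case. *)
have [even_n|odd_n] := boolP (odd n); last first.
  exists 0 => -[A1 [A2 [A3 [i1 i2 i3 AE]]]].
  have C3 : A1 + A2 = - A3 by apply/eqP; rewrite -addr_eq0 -AE.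
  have := sum2_invol_rank nz3 i1 i2; rewrite C3.
  have -> : - A3 + 1%:M = - (A3 - 1%:M) by rewrite opprB addrC.
  rewrite -opprD !mxrank_opp => eq_r.
  have := involutive_rankD nz2 i3; rewrite eq_r addnn => /(congr1 odd).
  by rewrite odd_double /= odd_n.
pose u : 'cV[F]_n.+1 := delta_mx 0 0; pose v : 'rV[F]_n.+1 := delta_mx 0 0.
have vu : v *m u = 1%:M by rewrite mul_delta_mx; apply/matrixP => i j; rewrite !ord1 !mxE.
exists (u *m v) => -[A1 [A2 [A3 [i1 i2 i3 AE]]]].
have tr0 B1 B2 B3 : involutive_mx B1 -> involutive_mx B2 -> involutive_mx B3 ->
    u *m v = B1 + B2 + B3 -> \tr B3 = 0.
  move=> j1 j2 j3 BE; apply: involutive_trace => //.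
  have rank_uv : (\rank (u *m v)%R <= 1)%N.
    exact: leq_trans (mxrankM_maxl _ _) (rank_leq_col _).
  have eqr := sum2_invol_rank nz3 j1 j2.
  have CE : B1 + B2 = u *m v - B3 by rewrite BE addrK.
  have Cp : B1 + B2 + 1%:M = u *m v - (B3 - 1%:M) by rewrite CE opprB addrA addrAC.
  have Cm : B1 + B2 - 1%:M = u *m v - (B3 + 1%:M) by rewrite CE opprD addrA.
  have lower Q : (\rank Q <= (\rank (u *m v - Q)%R).+1)%N.
    have {1}-> : Q = u *m v + - (u *m v - Q) by rewrite opprB addrC subrK.
    by apply: leq_trans (mxrank_add _ _) _; rewrite mxrank_opp; lia.
  have upper Q : (\rank (u *m v - Q)%R <= (\rank Q).+1)%N.
    by apply: leq_trans (mxrank_add _ _) _; rewrite mxrank_opp; lia.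
  have Qp : (B3 + 1%:M) *m (B3 + 1%:M) = 2%:R *: (B3 + 1%:M).
    rewrite mulmxDl !mulmxDr j3 !mulmx1 mul1mx.
    by apply/matrixP => i j; rewrite !mxE; ring.
  have Qm : (B3 - 1%:M) *m (B3 - 1%:M) = (- 2%:R) *: (B3 - 1%:M).
    rewrite mulmxBl !mulmxBr j3 !mulmx1 mul1mx.
    by apply/matrixP => i j; rewrite !mxE; ring.
  (* A rank drop would force [v u = 1] to equal 2 here, and -2 in [gem]. *)
  have gep : (\rank (B3 + 1%:M)%R <= \rank (u *m v - (B3 + 1%:M))%R)%N.
    rewrite leqNgt; apply/negP => /(rank1_drop Qp); rewrite vu => /matrixP/(_ 0 0).
    rewrite !mxE eqxx !mulr1n => e12; move: (oner_neq0 F).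
    have -> : 1 = 2%:R - 1 :> F by ring.
    by rewrite -e12 subrr eqxx.
  have gem : (\rank (B3 - 1%:M)%R <= \rank (u *m v - (B3 - 1%:M))%R)%N.
    rewrite leqNgt; apply/negP => /(rank1_drop Qm); rewrite vu => /matrixP/(_ 0 0).
    rewrite !mxE eqxx !mulr1n => e12; move/eqP: nz3; apply.
    have -> : 3%:R = 1 + 2%:R :> F by ring.
    by rewrite [X in X + _]e12 addNr.
  have := involutive_rankD nz2 j3 => /(congr1 odd); rewrite /= even_n /=.
  move: eqr (upper (B3 + 1%:M)) (upper (B3 - 1%:M)) gep gem; rewrite Cp Cm.
  (* The two eigenspace dimensions [a] and [b] differ by at most 1, and their sum is even. *)
  have arith (a b c d : nat) : c = d -> (d <= a.+1)%N -> (c <= b.+1)%N ->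
    (a <= d)%N -> (b <= c)%N -> odd (a + b) = false -> a = b by lia.
  exact: arith.
have /eqP : \tr (u *m v) = 0.
  rewrite AE !mxtraceD (tr0 A1 A2 A3) // (tr0 A1 A3 A2) //; last by rewrite AE addrAC.
  by rewrite (tr0 A2 A3 A1) ?addr0 // AE -addrA addrC.
by rewrite mxtrace_mulC vu mxtrace1 oner_eq0.
Qed.

(** * Consequences of (1) for the base ring *)

Lemma sum3_invol_map (R S : comPzRingType) (f : {rmorphism R -> S}) n (A : 'M[R]_n) :
  sum3_invol A -> sum3_invol (map_mx f A).
Proof.
move=> [A1 [A2 [A3 [i1 i2 i3 ->]]]].
exists (map_mx f A1), (map_mx f A2), (map_mx f A3).
by rewrite /involutive_mx -!map_mxM i1 i2 i3 map_mx1 -!map_mxD.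
Qed.

Section AllSum3.
Variables (R : comPzRingType) (n : nat).
Hypothesis sum3R : forall A : 'M[R]_n.+1, sum3_invol A.

Lemma all_sum3_half : exists z : R, 2%:R * z = 1.
Proof.
have tr2 (A : 'M[R]_n.+1) : exists z, \tr A ^+ 2 = n.+1%:R + 2%:R * z.
  have [A1 [A2 [A3 [i1 i2 i3 ->]]]] := sum3R A; rewrite !mxtraceD.
  have [z1 E1] := mxtrace_sqr A1; have [z2 E2] := mxtrace_sqr A2.
  have [z3 E3] := mxtrace_sqr A3.
  move: E1 E2 E3; rewrite i1 i2 i3 mxtrace1 => E1 E2 E3.
  exists (n.+1%:R + z1 + z2 + z3 +
    (\tr A1 * \tr A2 + \tr A1 * \tr A3 + \tr A2 * \tr A3)).
  transitivity (\tr A1 ^+ 2 + \tr A2 ^+ 2 + \tr A3 ^+ 2 +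
    2%:R * (\tr A1 * \tr A2 + \tr A1 * \tr A3 + \tr A2 * \tr A3)); first by ring.
  by rewrite E1 E2 E3; ring.
have [z0] := tr2 0; have [z1] := tr2 (delta_mx 0 0).
rewrite mxtrace0 [0 ^+ 2]expr2 mul0r => E1 E0; exists (z1 - z0).
have tr1 : \tr (delta_mx 0 0 : 'M[R]_n.+1) = 1.
  rewrite /mxtrace (bigD1 0) //= big1 => [|i ni]; rewrite mxE ?eqxx ?addr0 //.
  by rewrite (negPf ni).
transitivity (\tr (delta_mx 0 0 : 'M[R]_n.+1) ^+ 2 - 0).
  by rewrite [X in _ = _ - X]E0 E1; ring.
by rewrite tr1 expr1n subr0.
Qed.

Lemma all_sum3_poly (x : R) : x * (x ^+ 2 - 1) * (x ^+ 2 - 9%:R) = 0.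
Proof.
have [z z2] := all_sum3_half.
have [A1 [A2 [A3 [i1 i2 i3 AE]]]] := sum3R x%:M.
have eq0 := scalar_sum3 i1 i2 i3 AE.
transitivity (z * (2%:R * x * (x ^+ 2 - 1) * (x ^+ 2 - 9%:R))).
  by rewrite -[LHS]mul1r -[X in X * _ = _]z2; ring.
by rewrite eq0 mulr0.
Qed.

Lemma all_sum3_3 : 3%:R = 0 :> R.
Proof.
have [z z2] := all_sum3_half.
have r15 : 15%:R = 0 :> R.
  have p2 := all_sum3_poly 2%:R.
  transitivity (- (z * (2%:R * (2%:R ^+ 2 - 1) * (2%:R ^+ 2 - 9%:R))) : R).
    by rewrite -[LHS]mul1r -[X in X * _ = _]z2; ring.
  by rewrite p2 mulr0 oppr0.
(* In [Z/15], 6 is the idempotent that is 1 modulo 5 and 0 modulo 3; if nonzero in [R], it yields a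
   homomorphism to [F_5]. *)
suff r6 : 6%:R = 0 :> R.
  transitivity (15%:R - 2%:R * 6%:R : R); first by ring.
  by rewrite r15 r6; ring.
apply/eqP; apply: contrapT => /negP nz6.
have [||r|f _] := @residue_hom R 5 6%:R erefl _ nz6.
- transitivity (6%:R + 2%:R * 15%:R : R); first by ring.
  by rewrite r15; ring.
- by transitivity (2%:R * 15%:R : R); [ring|rewrite r15 mulr0].
(* Modulo 5 the product over all residues is [r (r^2 - 1) (r^2 - 9)], as 9 is 4. *)
- rewrite !big_ord_recr big_ord0 /=.
  transitivity (6%:R * (r * (r ^+ 2 - 1) * (r ^+ 2 - 9%:R)) +
    15%:R * (-4%:R * r ^+ 4 + 18%:R * r ^+ 3 - 20%:R * r ^+ 2 + 6%:R * r)).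
    by ring.
  by rewrite all_sum3_poly r15; ring.
have F5 : 5%:R = 0 :> 'F_5 by apply: val_inj.
have [A nA] := @not_sum3_invol_char5 _ n F5.
apply: nA; have := sum3_invol_map f (sum3R (map_mx (fun z : 'F_5 => (nat_of_ord z)%:R) A)).
congr sum3_invol; apply/matrixP => i j.
by rewrite !mxE rmorph_nat; apply: natr_Zp.
Qed.

(** Since [3 = 0], traces of involutions equal their cubes and cubing is additive; moreover every
    [x] is the trace of some matrix. *)
Lemma all_sum3_cube (x : R) : x ^+ 3 = x.
Proof.
have R3 := all_sum3_3.
have tr3 (A : 'M[R]_n.+1) : involutive_mx A -> \tr A ^+ 3 = \tr A.
  by move=> iA; have [z ->] := mxtrace_cube A; rewrite iA mul1mx R3 mul0r addr0.
have -> : x = \tr (x *: delta_mx 0 0 : 'M[R]_n.+1).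
  rewrite mxtraceZ /mxtrace (bigD1 0) //= big1 => [|i ni]; rewrite mxE ?eqxx.
    by rewrite addr0 mulr1.
  by rewrite (negPf ni).
have [A1 [A2 [A3 [i1 i2 i3 ->]]]] := sum3R (x *: delta_mx 0 0).
rewrite !mxtraceD -{2}(tr3 A1) // -{2}(tr3 A2) // -{2}(tr3 A3) //.
set a := \tr A1; set b := \tr A2; set c := \tr A3.
transitivity (a ^+ 3 + b ^+ 3 + c ^+ 3 + 3%:R * ((a + b) * (b + c) * (c + a))).
  by ring.
by rewrite R3; ring.
Qed.

(** If [d = x - y] is nonzero, [d^3 = d] makes [d^2] a nonzero idempotent, and a homomorphism
    sending it to 1 cannot kill [d]. *)
Lemma all_sum3_subdirect : subdirect_product_Z3 R.
Proof.
apply/subdirect_product_Z3P => x y fxy; apply: subr0_eq.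
apply/eqP; apply: contrapT => /negP; set d := x - y => nz_d.
have R3 := all_sum3_3; have d3 := all_sum3_cube d.
have [|||r|f fe] := @residue_hom R 3 (d ^+ 2) erefl.
- by transitivity (d ^+ 3 * d); [ring|rewrite d3 expr2].
- by apply: contraNneq nz_d => d20; rewrite -d3 exprS d20 mulr0.
- by rewrite R3 mulr0.
- rewrite !big_ord_recr big_ord0 /=.
  transitivity (d ^+ 2 * (r ^+ 3 - r + 3%:R * (r - r ^+ 2))); first by ring.
  by rewrite all_sum3_cube R3; ring.
have fd : f d = 0 by rewrite rmorphB (fxy f) subrr.
by move/eqP: fe; rewrite rmorphXn fd.
Qed.

End AllSum3.

Theorem theorem1p4 (R : comPzRingType) (n : nat) (hn : (1 <= n)%N) :
  (forall A : 'M[R]_n, exists A1 A2 A3 : 'M[R]_n,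
     [/\ involutive_mx A1, involutive_mx A2, involutive_mx A3
       & A = A1 + A2 + A3])
  <-> subdirect_product_Z3 R.
Proof.
split=> [|subR A]; last exact: subdirect_sum3.
by case: n hn => // n _; apply: all_sum3_subdirect.
Qed.
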